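(* For every function $f:X\to Y$, the assignment $\mathrm{Path}_\sim f([p]_\sim)=[f\circ p]_\sim$ (for $p\in\mathrm{Path}(X)$) is a well-defined function $\mathrm{Path}_\sim(X)\to\mathrm{Path}_\sim(Y)$, and $\mathrm{Path}_\sim$ is an endofunctor on the category of sets.
   Context: Fix a set $A$, $\tau\notin A$, $A_\tau=A\cup\{\tau\}$, $A_\tau^*$ the finite words, $\epsilon$ the empty word, ${\downarrow}\sigma$ the set of prefixes of $\sigma$. A path on $X$ is a function $p$ into $X$ with domain ${\downarrow}\sigma$ for some $\sigma\in A_\tau^*$; $\mathrm{Path}(X)$ is the set of paths. The stutter basis of $p$ is the unique $\phi:\mathrm{dom}\,p\to A_\tau^*$ with $\phi(\epsilon)=\epsilon$; $\phi(\sigma'\tau)=\phi(\sigma')$ if $p(\sigma'\tau)=p(\sigma')$; $\phi(\sigma'\tau)=\phi(\sigma')\tau$ if $p(\sigma'\tau)\ne p(\sigma')$; $\phi(\sigma'a)=\phi(\sigma')a$ for $a\in A$. $\mathrm{st}(p)$ is the path with domain $\phi(\mathrm{dom}\,p)$ such that $\mathrm{st}(p)\circ\phi=p$. $p\sim q$ iff $\mathrm{st}(p)=\mathrm{st}(q)$; $\mathrm{Path}_\sim(X)=\mathrm{Path}(X)/{\sim}$ with classes $[p]_\sim$. *)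

(* Defs.v *)
From HB Require Import structures.
From mathcomp Require Import all_boot generic_quotient.
From mathcomp Require Import boolp classical_sets.

Set Implicit Arguments.
Unset Strict Implicit.
Unset Printing Implicit Defensive.

Local Open Scope classical_set_scope.
Local Open Scope quotient_scope.

(* The letter [None] is the silent action tau; words grow on the right. *)
Notation word A := (seq (option A)).

Definition prefixes (A : Type) (s : word A) : set (word A) :=
  [set w | exists u, s = w ++ u].

(* A partial function into X is a map into [option X]; in this way, equality
   of paths is equality of domains and of values on them. *)
Definition dom (A X : Type) (p : word A -> option X) : set (word A) :=
  [set w | p w].

Record wpath (A X : Type) := WPath {
  path_fun :> word A -> option X;
  path_dom : exists s, dom path_fun = prefixes s
}.

HB.instance Definition _ (A X : Type) := gen_eqMixin (wpath A X).
HB.instance Definition _ (A X : Type) := gen_choiceMixin (wpath A X).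

Lemma path_eq (A X : Type) (p q : wpath A X) : p =1 q -> p = q.
Proof.
case: p q => [p hp] [q hq] /= /funext e.
by subst q; congr WPath; apply: Prop_irrelevance.
Qed.

Fixpoint stutter_basis_rev (A X : Type) (p : word A -> option X) (r : word A) :
    word A :=
  match r with
  | [::] => [::]
  | None :: r' =>
      if `[< p (rev (None :: r')) = p (rev r') >] then stutter_basis_rev p r'
      else rcons (stutter_basis_rev p r') None
  | Some a :: r' => rcons (stutter_basis_rev p r') (Some a)
  end.

(* Only the values on [dom p] matter; the four lemmas that follow are the
   defining equations, and [stutter_basis_unique] is their uniqueness. *)
Definition stutter_basis (A X : Type) (p : wpath A X) (w : word A) : word A :=
  stutter_basis_rev p (rev w).

Section StutterBasis.
Variables (A X : Type).
Implicit Types (p q : wpath A X) (s u v w : word A).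

Lemma stutter_basis_nil p : stutter_basis p [::] = [::].
Proof. by []. Qed.

Lemma stutter_basis_tau_eq p w : p (rcons w None) = p w ->
  stutter_basis p (rcons w None) = stutter_basis p w.
Proof.
by move=> e; rewrite /stutter_basis rev_rcons /= rev_cons revK asboolT.
Qed.

Lemma stutter_basis_tau_neq p w : p (rcons w None) <> p w ->
  stutter_basis p (rcons w None) = rcons (stutter_basis p w) None.
Proof.
by move=> e; rewrite /stutter_basis rev_rcons /= rev_cons revK asboolF.
Qed.

Lemma stutter_basis_act p w a :
  stutter_basis p (rcons w (Some a)) = rcons (stutter_basis p w) (Some a).
Proof. by rewrite /stutter_basis rev_rcons. Qed.

Lemma dom_prefix p w u : dom p (w ++ u) -> dom p w.
Proof.
case: (path_dom p) => s -> [v ->]; exists (u ++ v).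
by rewrite catA.
Qed.

Lemma stutter_basis_unique p (phi : word A -> word A) :
  phi [::] = [::] ->
  (forall w, dom p (rcons w None) -> p (rcons w None) = p w ->
     phi (rcons w None) = phi w) ->
  (forall w, dom p (rcons w None) -> p (rcons w None) <> p w ->
     phi (rcons w None) = rcons (phi w) None) ->
  (forall w a, dom p (rcons w (Some a)) ->
     phi (rcons w (Some a)) = rcons (phi w) (Some a)) ->
  forall w, dom p w -> phi w = stutter_basis p w.
Proof.
move=> h0 h1 h2 h3 w; elim/last_ind: w => [//|w [a|] IH] d.
  rewrite h3// stutter_basis_act IH//.
  by move: d; rewrite -cats1; apply: dom_prefix.
have dw : dom p w by move: d; rewrite -cats1; apply: dom_prefix.
have [e|e] := pselect (p (rcons w None) = p w).
  by rewrite h1// stutter_basis_tau_eq// IH.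
by rewrite h2// stutter_basis_tau_neq// IH.
Qed.

Lemma stutter_basis_size p w u :
  size (stutter_basis p w) <= size (stutter_basis p (w ++ u)).
Proof.
elim/last_ind: u => [|u c IH]; first by rewrite cats0.
apply: (leq_trans IH); rewrite -rcons_cat; case: c => [a|].
  by rewrite stutter_basis_act size_rcons.
have [e|e] := pselect (p (rcons (w ++ u) None) = p (w ++ u)).
  by rewrite stutter_basis_tau_eq.
by rewrite stutter_basis_tau_neq// size_rcons.
Qed.

Lemma stutter_basis_inj_cat p w u :
  stutter_basis p (w ++ u) = stutter_basis p w -> p (w ++ u) = p w.
Proof.
elim/last_ind: u => [|u c IH]; first by rewrite cats0.
rewrite -rcons_cat; case: c => [a|].
  rewrite stutter_basis_act => /(congr1 size); rewrite size_rcons => e.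
  by have := stutter_basis_size p w u; rewrite -e ltnn.
have [e|e] := pselect (p (rcons (w ++ u) None) = p (w ++ u)).
  by rewrite stutter_basis_tau_eq// e.
rewrite stutter_basis_tau_neq// => /(congr1 size); rewrite size_rcons => e'.
by have := stutter_basis_size p w u; rewrite -e' ltnn.
Qed.

Lemma cat_comparable w u w' u' : w ++ u = w' ++ u' ->
  (exists v, w' = w ++ v) \/ (exists v, w = w' ++ v).
Proof.
elim: w w' => [|c w IH] [|c' w'] /=.
- by left; exists [::].
- by left; exists (c' :: w').
- by right; exists (c :: w).
- by move=> [-> /IH[[v ->]|[v ->]]]; [left|right]; exists v.
Qed.

Lemma stutter_basis_inj p w w' : dom p w -> dom p w' ->
  stutter_basis p w = stutter_basis p w' -> p w = p w'.
Proof.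
case: (path_dom p) => s -> [u su] [u' su'] e.
have [[v ev]|[v ev]] := cat_comparable (etrans (esym su) su').
  by rewrite ev; apply/esym/stutter_basis_inj_cat; rewrite -ev.
by rewrite ev; apply/stutter_basis_inj_cat; rewrite -ev.
Qed.

Lemma stutter_basis_prefixes p s :
  stutter_basis p @` prefixes s = prefixes (stutter_basis p s).
Proof.
apply/seteqP; split => [_ [w [u ->] <-]|].
  elim/last_ind: u => [|u c [v IH]].
    by exists [::]; rewrite !cats0.
  rewrite -rcons_cat; case: c => [a|].
    by exists (rcons v (Some a)); rewrite stutter_basis_act IH rcons_cat.
  have [e|e] := pselect (p (rcons (w ++ u) None) = p (w ++ u)).
    by exists v; rewrite stutter_basis_tau_eq.
  by exists (rcons v None); rewrite stutter_basis_tau_neq// IH rcons_cat.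
elim/last_ind: s => [|s c IH] v.
  case=> u; rewrite stutter_basis_nil => e.
  exists [::]; first by exists [::].
  by case: v e.
have sub x : (stutter_basis p @` prefixes s) x ->
    (stutter_basis p @` prefixes (rcons s c)) x.
  move=> [w [u ->] <-]; exists w => //; exists (rcons u c).
  by rewrite rcons_cat.
have last_case x : stutter_basis p (rcons s c) = rcons (stutter_basis p s) x ->
    prefixes (stutter_basis p (rcons s c)) v ->
    (stutter_basis p @` prefixes (rcons s c)) v.
  move=> e [u]; case/lastP: u => [|u y].
    rewrite cats0 => <-; exists (rcons s c) => //.
    by exists [::]; rewrite cats0.
  rewrite e -rcons_cat => /rcons_inj[e' _].
  by apply: sub; apply: IH; exists u.
case: c sub last_case => [a|] sub last_case.
  by apply: last_case; apply: stutter_basis_act.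
have [e|e] := pselect (p (rcons s None) = p s).
  by rewrite stutter_basis_tau_eq// => /IH; apply: sub.
by apply: last_case; apply: stutter_basis_tau_neq.
Qed.

Definition is_st p q : Prop :=
  dom q = stutter_basis p @` dom p /\
  (forall w, dom p w -> q (stutter_basis p w) = p w).

Lemma st_exists p : exists q, is_st p q.
Proof.
pose g v := if pselect (exists w, dom p w /\ stutter_basis p w = v) is left h
  then p (projT1 (cid h)) else None.
have gE w : dom p w -> g (stutter_basis p w) = p w.
  move=> d; rewrite /g; case: pselect => [h|]; last by case; exists w.
  by case: (cid h) => w' /= [d' e]; apply: stutter_basis_inj.
have domg : dom g = stutter_basis p @` dom p.
  apply/seteqP; split => v.
    rewrite /dom /= {1}/g; case: pselect => // -[w [d e]] _.
    by exists w.
  by case=> w d <-; rewrite /dom /= gE.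
have pg : exists s, dom g = prefixes s.
  have [s e] := path_dom p.
  by exists (stutter_basis p s); rewrite domg e stutter_basis_prefixes.
by exists (WPath pg); split => // w d; exact: gE.
Qed.

Lemma st_unique p q q' : is_st p q -> is_st p q' -> q = q'.
Proof.
move=> [d e] [d' e']; apply: path_eq => v.
have [[w dw <-]|nv] := pselect ((stutter_basis p @` dom p) v).
  by rewrite e// e'.
have q0 : ~ dom q v by rewrite d.
have q0' : ~ dom q' v by rewrite d'.
move: q0 q0'; rewrite /dom /=.
by case: (q v) => [x|]; case: (q' v) => [y|] h h'.
Qed.

Definition st p : wpath A X := sval (cid (st_exists p)).

Lemma stP p : is_st p (st p).
Proof. by rewrite /st; case: cid. Qed.

Definition stutter_eq : rel (wpath A X) := fun p q => st p == st q.

Lemma stutter_eq_refl : reflexive stutter_eq.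
Proof. by move=> p; apply: eqxx. Qed.

Lemma stutter_eq_sym : symmetric stutter_eq.
Proof. by move=> p q; apply: eq_sym. Qed.

Lemma stutter_eq_trans : transitive stutter_eq.
Proof. by move=> q p r /eqP pq /eqP qr; apply/eqP; rewrite pq. Qed.

Canonical stutter_equiv :=
  EquivRel stutter_eq stutter_eq_refl stutter_eq_sym stutter_eq_trans.

End StutterBasis.

Definition wpath_sim (A X : Type) : Type := {eq_quot (stutter_equiv A X)}.

Definition class_sim (A X : Type) (p : wpath A X) : wpath_sim A X :=
  \pi_({eq_quot (stutter_equiv A X)}) p.

Lemma class_simP (A X : Type) (p q : wpath A X) :
  class_sim p = class_sim q <-> st p = st q.
Proof. by split => [/eqmodP/eqP|e]; [|apply/eqmodP/eqP]. Qed.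

Lemma class_sim_surj (A X : Type) (c : wpath_sim A X) :
  exists p, class_sim p = c.
Proof. by exists (repr c); apply: reprK. Qed.

Lemma wpath_map_dom (A X Y : Type) (f : X -> Y) (p : wpath A X) :
  exists s, dom (omap f \o p) = prefixes s.
Proof.
case: (path_dom p) => s e; exists s; rewrite -e.
by apply/seteqP; split=> w; rewrite /dom /=; case: (p w).
Qed.

Definition wpath_map (A X Y : Type) (f : X -> Y) (p : wpath A X) : wpath A Y :=
  WPath (wpath_map_dom f p).

(* The objects of the category of sets. Naming the sort forces source and
   target of an endofunctor to live in the same universe. *)
Definition SET := Type.

Definition is_set_endofunctor (F : SET -> SET)
    (map : forall X Y : SET, (X -> Y) -> F X -> F Y) : Prop :=
  (forall X : SET, map X X id = id) /\
  (forall (X Y Z : SET) (f : X -> Y) (g : Y -> Z),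
     map X Z (g \o f) = map Y Z g \o map X Y f).
Arguments is_set_endofunctor F map : clear implicits.

(* Main.v *)
(** The functorial action respects [~] because [st (f \o p)] depends on [p]
    only through [st p]: the stutter basis of [f \o p] is the stutter basis of
    [p] followed by that of [f \o st p], hence [st (f \o p) = st (f \o st p)]. *)

Require Import Defs.
From HB Require Import structures.
From mathcomp Require Import all_boot generic_quotient.
From mathcomp Require Import boolp classical_sets.

Lemma dom_wpath_map {A X Y : Type} (f : X -> Y) (p : wpath A X) :
  dom (wpath_map f p) = dom p.
Proof. by apply/seteqP; split=> w; rewrite /dom /=; case: (p w). Qed.

(** The composite satisfies the recursion that determines the basis of [f \o p]: the inner basis
    drops the tau steps on which [p] stutters, and the outer one drops those of the rest whose two
    values [f] merges. *)
Lemma stutter_basis_wpath_map {A X Y : Type} (f : X -> Y) (p q : wpath A X) w :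
  is_st p q -> dom p w ->
  stutter_basis (wpath_map f q) (stutter_basis p w) =
  stutter_basis (wpath_map f p) w.
Proof.
move=> [_ qE]; rewrite -(dom_wpath_map f).
pose phi w := stutter_basis (wpath_map f q) (stutter_basis p w).
apply: (@stutter_basis_unique _ _ _ phi) => // {}w; last first.
  by move=> a _; rewrite /phi !stutter_basis_act.
all: rewrite dom_wpath_map => dwt /=.
all: have dw : dom p w by move: dwt; rewrite -cats1; apply: dom_prefix.
(* Comparing values of [f \o p] becomes comparing values of [f \o q] along the inner basis. *)
all: rewrite -(qE _ dwt) -(qE _ dw) /phi.
all: have [e|e] := pselect (p (rcons w None) = p w).
(* Contradictory case: [f \o p] cannot move where [p] stutters. *)
- by rewrite (stutter_basis_tau_eq e).
- by rewrite (stutter_basis_tau_neq e) => ?; apply: stutter_basis_tau_neq.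
- by rewrite (stutter_basis_tau_eq e).
- by rewrite (stutter_basis_tau_neq e) => ?; apply: stutter_basis_tau_eq.
Qed.

Lemma st_wpath_map {A X Y : Type} (f : X -> Y) (p : wpath A X) :
  st (wpath_map f p) = st (wpath_map f (st p)).
Proof.
have pq := stP p; have [dq qE] := pq.
(* It remains to check that [st (f \o st p)] has the domain and values that characterize
   [st (f \o p)]. *)
apply: st_unique (stP _) _; have [dr rE] := stP (wpath_map f (st p)).
split=> [|w].
  rewrite dr !dom_wpath_map dq image_comp.
  by apply: eq_imagel => w dw /=; apply: stutter_basis_wpath_map.
rewrite dom_wpath_map => dw; rewrite -(stutter_basis_wpath_map _ _ _ _ pq dw).
rewrite rE /= ?qE// dom_wpath_map dq.
by exists w.
Qed.

Lemma stutter_eq_wpath_map {A X Y : Type} (f : X -> Y) (p q : wpath A X) :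
  stutter_eq p q -> stutter_eq (wpath_map f p) (wpath_map f q).
Proof.
by move=> /eqP pq; rewrite /stutter_eq st_wpath_map pq -st_wpath_map.
Qed.

(** Independence of the chosen representative is [wpath_sim_map_class]. *)
Definition wpath_sim_map {A X Y : Type} (f : X -> Y) (c : wpath_sim A X) :
  wpath_sim A Y := class_sim (wpath_map f (repr c)).

Lemma wpath_sim_map_class {A X Y : Type} (f : X -> Y) (p : wpath A X) :
  wpath_sim_map f (class_sim p) = class_sim (wpath_map f p).
Proof.
apply/class_simP/eqP; apply: stutter_eq_wpath_map.
by apply/eqP/class_simP; apply: reprK.
Qed.

Lemma wpath_map_id {A X : Type} (p : wpath A X) : wpath_map id p = p.
Proof. by apply: path_eq => w /=; case: (p w). Qed.

Lemma wpath_map_comp {A X Y Z : Type} (f : X -> Y) (g : Y -> Z)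
    (p : wpath A X) :
  wpath_map (g \o f) p = wpath_map g (wpath_map f p).
Proof. by apply: path_eq => w /=; case: (p w). Qed.

Theorem theorem8 (A : Type) :
  (forall (X Y : SET) (f : X -> Y) (p q : wpath A X),
     stutter_eq p q -> stutter_eq (wpath_map f p) (wpath_map f q)) /\
  exists map : forall X Y : SET, (X -> Y) -> wpath_sim A X -> wpath_sim A Y,
    (forall (X Y : SET) (f : X -> Y) (g : wpath_sim A X -> wpath_sim A Y),
       (forall p : wpath A X, g (class_sim p) = class_sim (wpath_map f p)) <->
       g = map X Y f) /\
    is_set_endofunctor (wpath_sim A) map.
Proof.
split=> [X Y f p q|]; first exact: stutter_eq_wpath_map.
exists (fun X Y f => @wpath_sim_map A X Y f); split=> [X Y f g|].
  split=> [gE|-> p]; last exact: wpath_sim_map_class.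
  (* Uniqueness: every class comes from a path, so the formula on classes of paths fixes [g]
     everywhere. *)
  by apply/funext => c; have [p <-] := class_sim_surj c;
    rewrite gE wpath_sim_map_class.
(* Both functor laws descend from the same laws on paths. *)
split=> [X|X Y Z f g]; apply/funext => c; have [p <-] := class_sim_surj c.
  by rewrite wpath_sim_map_class wpath_map_id.
by rewrite /= !wpath_sim_map_class wpath_map_comp.
Qed.
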